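(* Let $n\ge 1$, let $X_1,\dots,X_n,X'_1,\dots,X'_n$ be independent real random variables with $X_k$ and $X'_k$ identically distributed for each $k$, let $S:\mathbb{R}^n\to\mathbb{R}$ be Borel with $\mathbb{E}\,S(X_1,\dots,X_n)^2<+\infty$, and let $(B_k)_{1\le k\le n}$ be the associated finite sequence defined in the context. Then for all $\ell\in\{0,\dots,n-1\}$ and $k\in\{1,\dots,n-\ell\}$, $$D^\ell B_k=\mathbb{E}\,\frac{1}{2^{\ell+1}n!}\sum_{i\in\mathfrak{S}_n}(\Delta_{i_1,\dots,i_{\ell+1}}S)(\Delta_{i_1,\dots,i_{\ell+1}}S)^{i_{\ell+2},\dots,i_{k+\ell}}.$$ In particular, $D^\ell B_k\ge 0$ for all such $\ell,k$, i.e., $(B_k)_{1\le k\le n}$ is completely monotone.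
   Context: Write $S$ for $S(X_1,\dots,X_n)$. For $\alpha\subset\{1,\dots,n\}$, $S^\alpha$ denotes $S(X_1,\dots,X_n)$ with $X_k$ replaced by $X'_k$ for every $k\in\alpha$ (so $S^\emptyset=S$); $S^{i_1,\dots,i_j}:=S^{\{i_1,\dots,i_j\}}$. For a random variable that is a linear combination of terms $S^{\alpha'}$ with $\alpha'\subset\alpha$, and $\beta$ disjoint from $\alpha$, the superscript $\beta$ means that $X_k$ is replaced by $X'_k$ for all $k\in\beta$, i.e. $S^{\alpha'}$ becomes $S^{\alpha'\cup\beta}$. Set $\Delta_kS:=S-S^k$ and iterate: for distinct indices, $\Delta_{i_1,\dots,i_k}S:=\Delta_{i_k}(\Delta_{i_1,\dots,i_{k-1}}S)$; equivalently, for $\alpha=\{i_1,\dots,i_k\}$, $\Delta_\alpha S=\sum_{\alpha'\subset\alpha}(-1)^{|\alpha'|}S^{\alpha'}$. $\mathfrak{S}_n$ is the symmetric group, and for $i\in\mathfrak{S}_n$ one writes $i_j=i(j)$. For $k\in\{1,\dots,n\}$, $$B_k:=\mathbb{E}\,\frac{1}{n!}\sum_{i\in\mathfrak{S}_n}S\,(S^{i_1,\dots,i_{k-1}}-S^{i_1,\dots,i_k}),$$ where for $k=1$, $S^{i_1,\dots,i_{k-1}}=S$. An empty list of superscripts means no replacement. $D$ is the operator on finite sequences given by $DB_k:=B_k-B_{k+1}$, $D^\ell$ is its $\ell$-th iterate (so $D^\ell B_k$ is defined for $1\le k\le n-\ell$), and $D^0=\mathrm{Id}$. A finite sequence $(b_k)_{1\le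 k\le n}$ is completely monotone if $D^\ell b_k\ge0$ for all $\ell\in\{0,\dots,n-1\}$, $k\in\{1,\dots,n-\ell\}$. *)

(* Defs.v *)
From HB Require Import structures.
From mathcomp Require Import all_boot all_order all_algebra all_fingroup.
From mathcomp Require Import all_classical all_reals all_analysis.

Set Implicit Arguments.
Unset Strict Implicit.
Unset Printing Implicit Defensive.

Import Order.TTheory GRing.Theory Num.Theory.
Import numFieldNormedType.Exports.

Local Open Scope classical_set_scope.
Local Open Scope ring_scope.

Definition identically_distributed d (T : measurableType d) (R : realType)
    (P : probability T R) (X Y : {RV P >-> R}) : Prop :=
  (* restricted to measurable sets: [distribution] is a function on all sets *)
  forall A : set R, measurable A -> distribution P X A = distribution P Y A.

Definition mutually_independent d (T : measurableType d) (R : realType)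
    (P : probability T R) (I : finType) (X : I -> {RV P >-> R}) : Prop :=
  forall (J : {set I}) (A : I -> set R), (forall j, measurable (A j)) ->
    P (\bigcap_(j in [set` J]) (X j @^-1` A j)) =
    (\prod_(j in J) P (X j @^-1` A j))%E.

Definition pair_family n (U : Type) (X X' : 'I_n -> U) (s : 'I_n + 'I_n) : U :=
  match s with inl k => X k | inr k => X' k end.

Section Resampling.
Context {R : realType} {n : nat}.

(* Every random variable obtained from S by replacements and linear
   combinations is F (X_1, ..., X_n) (X'_1, ..., X'_n) for a deterministic F of
   this type, and the superscript operation acts on F. *)
Definition functional := n.-tuple R -> n.-tuple R -> R.

Implicit Types (F : functional) (S : n.-tuple R -> R) (a b : {set 'I_n}).

Definition of_fun S : functional := fun x _ => S x.

Definition replace a (x x' : n.-tuple R) : n.-tuple R :=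
  [tuple if k \in a then tnth x' k else tnth x k | k < n].

Definition superscript F a : functional := fun x x' => F (replace a x x') x'.

Definition Delta1 F (k : 'I_n) : functional :=
  fun x x' => F x x' - superscript F [set k]%SET x x'.

Definition Delta F (s : seq 'I_n) : functional := foldl Delta1 F s.

Definition rv_of d (T : measurableType d) (P : probability T R)
    (X X' : 'I_n -> {RV P >-> R}) F : T -> R :=
  fun w => F [tuple X k w | k < n] [tuple X' k w | k < n].

(* i_p, i_(p+1), ..., i_q with positions counted from 1, as in i_1, ..., i_n
   (hence the [j.+1] for j : 'I_n); empty if q < p. *)
Definition indices (i : 'S_n) (p q : nat) : seq 'I_n :=
  [seq i j | j : 'I_n <- enum 'I_n & (p <= j.+1 <= q)%N].

Definition superscript_seq F (s : seq 'I_n) : functional :=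
  superscript F [set:: s]%SET.

(* The expectation is finite whenever S(X_1, ..., X_n) is square integrable. *)
Definition B d (T : measurableType d) (P : probability T R)
    (X X' : 'I_n -> {RV P >-> R}) S (k : nat) : R :=
  fine ('E_P[fun w => ((n`!%:R)^-1 * \sum_(i : 'S_n)
     rv_of X X' (of_fun S) w *
     (rv_of X X' (superscript_seq (of_fun S) (indices i 1 k.-1)) w -
      rv_of X X' (superscript_seq (of_fun S) (indices i 1 k)) w))%R]%E).

(* The two lemmas below check the encoding: (S^a)^b = S^(a U b), and Delta is
   the alternating sum over subsets. *)
Lemma superscript_of_fun S a b :
  superscript (superscript (of_fun S) a) b = superscript (of_fun S) (a :|: b)%SET.
Proof.
apply/funext => x; apply/funext => x'; rewrite /superscript /of_fun.
congr S; apply: eq_from_tnth => k; rewrite !tnth_mktuple inE.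
by case: (k \in a).
Qed.

Lemma DeltaE S (s : seq 'I_n) : uniq s ->
  Delta (of_fun S) s = fun x x' =>
    \sum_(a : {set 'I_n} | a \subset [set:: s]%SET)
       (-1) ^+ #|a| * superscript (of_fun S) a x x'.
Proof.
elim/last_ind: s => [_|s k IHs].
  apply/funext => x; apply/funext => x'.
  rewrite /Delta /= (big_pred1 finset.set0) => [|a].
    rewrite cards0 expr0 mul1r /superscript /of_fun; congr S.
    by apply: eq_from_tnth => k; rewrite tnth_mktuple inE.
  have -> : [set:: [::]]%SET = finset.set0 :> {set 'I_n} by apply/setP => j; rewrite !inE.
  by rewrite finset.subset0.
rewrite rcons_uniq => /andP[ks us].
apply/funext => x; apply/funext => x'.
rewrite /Delta -cats1 foldl_cat /= -/(Delta (of_fun S) s) (IHs us).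
rewrite [RHS](bigID (fun a : {set 'I_n} => k \in a)) /= addrC /Delta1; congr (_ + _).
  apply: eq_bigl => a; apply/idP/andP => [/fintype.subsetP h|[/fintype.subsetP h ka]].
    split.
      by apply/fintype.subsetP => j /h; rewrite !inE mem_cat => ->.
    by apply/negP => /h; rewrite inE (negbTE ks).
  apply/fintype.subsetP => j ja; have := h _ ja.
  rewrite !inE mem_cat inE => /orP[//|/eqP jk]; by rewrite -jk ja in ka.
rewrite -sumrN [RHS](reindex_onto (fun a => k |: a)%SET (fun a => a :\ k)%SET) /=; last first.
  by move=> a /andP[_ ka]; rewrite finset.setD1K.
apply: eq_big => [a|a /fintype.subsetP h].
  rewrite setU11 andbT; apply/idP/andP => [/fintype.subsetP h|[/fintype.subsetP h /eqP ak]].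
    split.
      apply/fintype.subsetP => j; rewrite !inE mem_cat inE => /orP[->|/h]; first by rewrite orbT.
      by rewrite inE => ->.
    apply/eqP/finset.setU1K; apply/negP => /h; by rewrite inE (negbTE ks).
  apply/fintype.subsetP => j ja; have := h j; rewrite !inE mem_cat inE ja orbT.
  move=> /(_ isT)/orP[//|/eqP jk]; move: ja; by rewrite -ak jk !inE eqxx.
have ka : k \notin a by apply/negP => /h; rewrite inE (negbTE ks).
rewrite cardsU1 ka exprS mulN1r mulNr; congr (- (_ * _)).
by rewrite -[LHS]/(superscript (superscript (of_fun S) a) [set k]%SET x x') superscript_of_fun finset.setUC.
Qed.

End Resampling.

Definition D {R : realType} (b : nat -> R) : nat -> R :=
  fun k => b k - b k.+1.

Definition completely_monotone {R : realType} (n : nat) (b : nat -> R) : Prop :=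
  forall l k : nat, (l < n)%N -> (1 <= k <= n - l)%N -> 0 <= iter l D b k.

(* Main.v *)
From HB Require Import structures.
Require Import Defs.
From mathcomp Require Import all_boot all_order all_algebra all_fingroup.
From mathcomp Require Import all_classical all_reals all_analysis.
From mathcomp Require Import measurable_realfun lra.

Set Implicit Arguments.
Unset Strict Implicit.
Unset Printing Implicit Defensive.

Import Order.TTheory GRing.Theory Num.Theory.
Import numFieldNormedType.Exports.

Local Open Scope classical_set_scope.
Local Open Scope ring_scope.

(* Exchanging X_k and X'_k for all k in a preserves the joint law and turns S^b
   into S^(a + b), where + is the symmetric difference, so that E S^a S^b equals
   m(a + b) for m(c) := E S S^c. Hence B_k is a first difference of
   M_j := average of m(i_1, ..., i_j) over the permutations i, D^l B_k is an
   (l+1)-st difference of M, and for alpha = {i_1, ..., i_(l+1)} the double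
   alternating sum over the subsets of alpha in
   E (Delta_alpha S) (Delta_alpha S)^beta collapses to 2^(l+1) times an
   alternating sum of m(c U beta); averaging over i gives the identity.
   For the sign, Delta_alpha S = f(Y, W) with Y = (X_k, k in beta) independent
   of W, and (Delta_alpha S)^beta = f(Y', W) with Y' an independent copy of Y,
   so that the expectation of the product is E (E[f(Y, W) | W]^2). *)

(** * Symmetric differences, signed subset sums, sums over permutations *)

Section FiniteSets.
Variable I : finType.
Implicit Types a b c A : {set I}.

Definition symdiff a b : {set I} := ((a :\: b) :|: (b :\: a))%SET.

Lemma in_symdiff a b x : (x \in symdiff a b) = (x \in a) (+) (x \in b).
Proof. by rewrite !inE; case: (x \in a); case: (x \in b). Qed.

Lemma symdiffK a : involutive (symdiff a).
Proof. by move=> b; apply/setP => x; rewrite !in_symdiff addKb. Qed.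

Lemma symdiff_subset a b A : a \subset A ->
  (symdiff a b \subset A) = (b \subset A).
Proof.
move=> /fintype.subsetP aA; apply/fintype.subsetP/fintype.subsetP => h x.
  move=> xb; case: (boolP (x \in a)) => [/aA //|xa]; apply: h.
  by rewrite in_symdiff (negbTE xa) xb.
by rewrite in_symdiff; case: (boolP (x \in a)) => [/aA //|_ /= /h].
Qed.

(** Parity is additive because the intersection is counted once in [a] and once in [b], so its sign
    enters squared. *)
Lemma signr_symdiff (R : comPzRingType) a b :
  (-1) ^+ #|symdiff a b| = (-1) ^+ #|a| * (-1) ^+ #|b| :> R.
Proof.
have dis : ((a :\: b) :&: (b :\: a))%SET = finset.set0.
  by apply/setP => x; rewrite !inE; case: (x \in a); case: (x \in b).
have -> : #|symdiff a b| = (#|(a :\: b)%SET| + #|(b :\: a)%SET|)%N.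
  by rewrite /symdiff cardsU dis cards0 subn0.
rewrite -(cardsID b a) -(cardsID a b) !exprD (finset.setIC b a).
by rewrite mulrACA -expr2 sqrr_sign mul1r.
Qed.

Lemma sum_subset_setU1 (V : nmodType) x A (f : {set I} -> V) : x \notin A ->
  \sum_(c : {set I} | c \subset (x |: A)%SET) f c =
  \sum_(c : {set I} | c \subset A) f c +
  \sum_(c : {set I} | c \subset A) f (x |: c)%SET.
Proof.
move=> xA; rewrite (bigID (fun c : {set I} => x \in c)) /= addrC; congr (_ + _).
  apply: eq_bigl => c.
  by rewrite -finset.subsetD1 finset.setU1K.
rewrite (reindex_onto (fun c => x |: c)%SET (fun c => c :\ x)%SET) /=;
  last first.
  by move=> c /andP[_ xc]; rewrite finset.setD1K.
apply: eq_bigl => c; rewrite setU11 andbT.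
apply/andP/idP => [[s /eqP e]|s].
  by rewrite -e -(finset.setU1K xA) finset.setSD.
split; first by rewrite finset.setUS.
by apply/eqP/finset.setU1K; apply: contra xA => /(fintype.subsetP s).
Qed.

(** For fixed [a] inside [A], [symdiff a] is an involution of the subsets of [A] which absorbs the
    sign of [a]. The inner sum is therefore the same for each of the [2 ^+ #|A|] choices of [a]. *)
Lemma sum_symdiff_subset (R : comPzRingType) A (h : {set I} -> R) :
  \sum_(a : {set I} | a \subset A) \sum_(b : {set I} | b \subset A)
     (-1) ^+ #|a| * (-1) ^+ #|b| * h (symdiff a b) =
  2 ^+ #|A| * \sum_(c : {set I} | c \subset A) (-1) ^+ #|c| * h c.
Proof.
transitivity (\sum_(a : {set I} | a \subset A)
    \sum_(c : {set I} | c \subset A) (-1) ^+ #|c| * h c).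
  apply: eq_bigr => a aA.
  rewrite [RHS](reindex_inj (inv_inj (symdiffK a))) /=.
  by apply: eq_big => b; [rewrite symdiff_subset|rewrite signr_symdiff].
rewrite sumr_const -natrX -card_powerset mulr_natl; congr (_ *+ _).
by apply: eq_card => a; rewrite powersetE.
Qed.

(** List each set followed by its complement and match equal positions of the two lists: the initial
    segments, of equal length, correspond. *)
Lemma perm_imset_card a b : #|a| = #|b| ->
  exists t : {perm I}, (t @: a)%SET = b.
Proof.
move=> ab.
pose l c := enum c ++ enum (~: c)%SET.
have lE c x : x \in l c by rewrite mem_cat !mem_enum inE orbN.
have lu c : uniq (l c).
  rewrite cat_uniq !enum_uniq /= andbT; apply/hasPn => x.
  by rewrite !mem_enum inE.
have ls c : size (l c) = #|I|.
  by rewrite size_cat -!cardE cardsC.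
have sab x : (index x (l a) < size (l b))%N by rewrite ls -(ls a) index_mem.
(* The default of [nth] is [x] itself, never reached by [sab]; injectivity must first make the two
   defaults agree. *)
pose f x := nth x (l b) (index x (l a)).
have f_inj : injective f.
  move=> x y; rewrite /f (set_nth_default x y)// => /eqP.
  by rewrite nth_uniq// => /eqP/(congr1 (nth x (l a))); rewrite !nth_index.
exists (perm f_inj); apply/eqP.
rewrite eqEcard card_imset ?ab ?leqnn ?andbT//; last exact: perm_inj.
apply/fintype.subsetP => _ /imsetP[x xa ->]; rewrite permE /f.
have xi : (index x (l a) < size (enum b))%N.
  by rewrite -cardE -ab cardE /l index_cat mem_enum xa index_mem mem_enum.
by rewrite nth_cat xi -mem_enum mem_nth.
Qed.

(** Translation by a permutation carrying [a] to [b] reindexes the symmetric group, so the sum sees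
    only the cardinality of the set. *)
Lemma sum_perm_imset (V : nmodType) (m : {set I} -> V) a b : #|a| = #|b| ->
  \sum_(i : {perm I}) m (i @: a)%SET = \sum_(i : {perm I}) m (i @: b)%SET.
Proof.
move=> /perm_imset_card[t <-].
rewrite (reindex_inj (mulgI t)) /=; apply: eq_bigr => i _; congr m.
by rewrite -imset_comp; apply: eq_imset => x; rewrite permM.
Qed.

Lemma sum_subset_imset (V : nmodType) (i : {perm I}) A (f : {set I} -> V) :
  \sum_(c : {set I} | c \subset (i @: A)%SET) f c =
  \sum_(c : {set I} | c \subset A) f (i @: c)%SET.
Proof.
rewrite (reindex_inj (imset_inj (@perm_inj _ i))) /=; apply: eq_bigl => c.
apply/idP/idP => [h|/imsetS]; last exact.
apply/fintype.subsetP => x xc; have /(fintype.subsetP h) := imset_f i xc.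
by rewrite mem_imset//; exact: perm_inj.
Qed.

End FiniteSets.

(** * Iterated differences as signed sums over subsets *)

Section FiniteDifferences.
Variable R : realType.
Implicit Types b : nat -> R.

(** Summing over subsets rather than with binomial coefficients gives the shape of the expansion of
    [Delta]. Removing a point [x] from [A] peels off one [D]: the subsets containing [x] supply the
    shifted term with the opposite sign. *)
Lemma iter_D_sum (I : finType) (A : {set I}) b k :
  iter #|A| D b k =
  \sum_(c : {set I} | c \subset A) (-1) ^+ #|c| * b (k + #|c|)%N.
Proof.
move: k; have [N] := ubnP #|A|; elim: N A => // N IH A.
have [->|[x xA]] := set_0Vmem A.
  move=> _ k; rewrite cards0 /= (big_pred1 finset.set0) ?cards0 ?addn0 ?mul1r//.
  by move=> c; rewrite finset.subset0.
have xA' : x \notin (A :\ x)%SET by rewrite !inE eqxx.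
rewrite (cardsD1 x) xA /= add1n ltnS => AN k.
rewrite -[in RHS](finset.setD1K xA) sum_subset_setU1//= {1}/D !IH//.
congr (_ + _).
rewrite -sumrN; apply: eq_bigr => c cA.
have xc : x \notin c by apply: contra xA' => /(fintype.subsetP cA).
by rewrite cardsU1 xc add1n exprS mulN1r mulNr addSnnS.
Qed.

Lemma iter_D_shift l (b c : nat -> R) k : (forall j, b j.+1 = c j) ->
  iter l D b k.+1 = iter l D c k.
Proof. by move=> bc; elim: l k => //= l IH k; rewrite /D !IH. Qed.

End FiniteDifferences.

Lemma set_seq_indices n (i : 'S_n) p q :
  [set:: indices i p q]%SET = (i @: [set j : 'I_n | p <= j.+1 <= q]%N)%SET.
Proof.
apply/setP => x; rewrite inE; apply/mapP/imsetP => [[j]|[j]].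
  by rewrite mem_filter => /andP[jpq _] ->; exists j; rewrite ?inE.
by rewrite inE => jpq ->; exists j => //; rewrite mem_filter jpq mem_enum.
Qed.

Lemma uniq_indices n (i : 'S_n) p q : uniq (indices i p q).
Proof. by rewrite (map_inj_uniq perm_inj) filter_uniq// enum_uniq. Qed.

Lemma card_ord_interval n p q : (q <= n)%N ->
  #|[set j : 'I_n | (p.+1 <= j.+1 <= q)%N]%SET| = (q - p)%N.
Proof.
move=> qn; rewrite -sum1_card -[RHS]muln1 -sum_nat_const_nat.
rewrite (big_nat_widenl _ 0%N)// (big_nat_widen _ _ n)// big_mkord.
by apply: eq_bigl => j; rewrite inE.
Qed.

(** * Transfer of integrals between maps with the same law *)

Section SameLaw.
Local Open Scope ereal_scope.
Context d1 d2 d (T1 : measurableType d1) (T2 : measurableType d2)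
  (Y : measurableType d) (R : realType).
Variables (m1 : {measure set T1 -> \bar R}) (m2 : {measure set T2 -> \bar R}).
Variables (f1 : T1 -> Y) (f2 : T2 -> Y).
Hypotheses (mf1 : measurable_fun setT f1) (mf2 : measurable_fun setT f2).
Hypothesis same_law : forall A, measurable A ->
  m1 (f1 @^-1` A) = m2 (f2 @^-1` A).

Let ge0_integral_same_law (F : Y -> \bar R) : measurable_fun setT F ->
  (forall y, 0 <= F y) -> \int[m1]_x F (f1 x) = \int[m2]_x F (f2 x).
Proof.
move=> mF F0.
pose g1 : {mfun T1 >-> Y} := HB.pack f1 (isMeasurableFun.Build _ _ _ _ _ mf1).
pose g2 : {mfun T2 >-> Y} := HB.pack f2 (isMeasurableFun.Build _ _ _ _ _ mf2).
rewrite -[LHS](@ge0_integral_pushforward _ _ _ _ _ g1 _ m1 setT)//.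
rewrite -[RHS](@ge0_integral_pushforward _ _ _ _ _ g2 _ m2 setT)//.
by apply: eq_measure_integral => A mA _; exact: same_law.
Qed.

Lemma integral_same_law (F : Y -> \bar R) : measurable_fun setT F ->
  \int[m1]_x F (f1 x) = \int[m2]_x F (f2 x).
Proof.
move=> mF; rewrite integralE [RHS]integralE; congr (_ - _).
  rewrite (_ : (fun x => F (f1 x))^\+ = F^\+ \o f1); last exact: funepos_comp.
  rewrite (_ : (fun x => F (f2 x))^\+ = F^\+ \o f2); last exact: funepos_comp.
  by apply: (@ge0_integral_same_law F^\+) => //; exact: measurable_funepos.
rewrite (_ : (fun x => F (f1 x))^\- = F^\- \o f1); last exact: funeneg_comp.
rewrite (_ : (fun x => F (f2 x))^\- = F^\- \o f2); last exact: funeneg_comp.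
by apply: (@ge0_integral_same_law F^\-) => //; exact: measurable_funeneg.
Qed.

Lemma integrable_same_law (F : Y -> \bar R) : measurable_fun setT F ->
  m1.-integrable setT (F \o f1) -> m2.-integrable setT (F \o f2).
Proof.
move=> mF /integrableP[_ h]; apply/integrableP; split.
  exact: measurableT_comp.
rewrite -(@integral_same_law (abse \o F))//.
exact: measurableT_comp.
Qed.

End SameLaw.

(** * Boxes as a generating pi-system for pairs of tuples *)

Section TupleBoxes.
Context {R : realType} {n : nat}.
Local Notation pairT := (n.-tuple R * n.-tuple R)%type.

Definition box (A A' : 'I_n -> set R) : set pairT :=
  [set z | forall k, A k (tnth z.1 k) /\ A' k (tnth z.2 k)].

Definition boxes : set (set pairT) :=
  [set C | exists A A', [/\ forall k, measurable (A k),
     forall k, measurable (A' k) & C = box A A']].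

Lemma measurable_box A A' : (forall k, measurable (A k)) ->
  (forall k, measurable (A' k)) -> measurable (box A A').
Proof.
move=> mA mA'.
have -> : box A A' = \bigcap_(k in [set: 'I_n])
    (((@tnth n R)^~ k \o fst) @^-1` A k `&`
     ((@tnth n R)^~ k \o snd) @^-1` A' k).
  by apply/seteqP; split => z /= h k => [_|]; exact: h.
apply: fin_bigcap_measurable => [|k _]; first exact: finite_finset.
apply: measurableI; rewrite -[X in measurable X]setTI.
  by apply: (measurableT_comp (measurable_tnth k) measurable_fst).
by apply: (measurableT_comp (measurable_tnth k) measurable_snd).
Qed.

Lemma measurable_boxes : measurable = <<s boxes >>.
Proof.
apply/seteqP; split; last first.
  apply: smallest_sub; first exact: sigma_algebra_measurable.
  by move=> _ [A [A' [mA mA' ->]]]; exact: measurable_box.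
(* It suffices that the identity out of the space generated by boxes be measurable. This is checked
   coordinate by coordinate: the preimage of [C] under one coordinate is a box whose other sides are
   the whole line. *)
pose f : g_sigma_algebraType boxes -> pairT := id.
suff mf : measurable_fun setT f.
  by move=> C mC; have := mf measurableT _ mC; rewrite setTI.
have mone k (C : set R) j : measurable C ->
    measurable (if j == k then C else setT).
  by move=> mC; case: ifP.
have mT : forall j : 'I_n, measurable [set: R] by [].
apply/measurable_fun_pairP; split; apply/measurable_fun_tnthP => k _ C mC;
    rewrite setTI; apply: sub_sigma_algebra.
  exists (fun j => if j == k then C else setT), (fun=> setT); split => //.
    by move=> j; exact: mone.
  apply/seteqP; split => [z Cz j|z /(_ k)[]]; last by rewrite eqxx.
  by split => //; case: eqP => // ->.
exists (fun=> setT), (fun j => if j == k then C else setT); split => //.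
  by move=> j; exact: mone.
apply/seteqP; split => [z Cz j|z /(_ k)[_]]; last by rewrite eqxx.
by split => //; case: eqP => // ->.
Qed.

Lemma boxes_setI : setI_closed boxes.
Proof.
move=> _ _ [A [A' [mA mA' ->]]] [B [B' [mB mB' ->]]].
exists (fun k => A k `&` B k), (fun k => A' k `&` B' k); split.
- by move=> k; exact: measurableI.
- by move=> k; exact: measurableI.
- apply/seteqP; split => [z [h1 h2] k|z h].
    have [[? ?] [? ?]] := (h1 k, h2 k).
    by split; split.
  by split => k; have [[? ?] [? ?]] := h k; split.
Qed.

End TupleBoxes.

(** Boxes form a generating pi-system and the total mass is finite, so uniqueness of measures
    applies. With [P2] a mere measure, iterated products of probabilities fit directly. *)
Lemma same_law_boxes d1 d2 (T1 : measurableType d1) (T2 : measurableType d2)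
    (R : realType) n (P1 : probability T1 R) (P2 : {measure set T2 -> \bar R})
    (f1 : T1 -> n.-tuple R * n.-tuple R) (f2 : T2 -> n.-tuple R * n.-tuple R) :
  measurable_fun setT f1 -> measurable_fun setT f2 ->
  (forall A A', (forall k, measurable (A k)) -> (forall k, measurable (A' k)) ->
     P1 (f1 @^-1` box A A') = P2 (f2 @^-1` box A A')) ->
  forall C, measurable C -> P1 (f1 @^-1` C) = P2 (f2 @^-1` C).
Proof.
move=> mf1 mf2 h C mC.
pose g1 : {mfun T1 >-> _} := HB.pack f1 (isMeasurableFun.Build _ _ _ _ _ mf1).
pose g2 : {mfun T2 >-> _} := HB.pack f2 (isMeasurableFun.Build _ _ _ _ _ mf2).
apply: (measure_unique boxes (fun=> setT) measurable_boxes boxes_setI _ _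
  (pushforward P1 g1) (pushforward P2 g2) _ _ C mC).
- move=> _; exists (fun=> setT), (fun=> setT); split => //.
  by apply/seteqP; split.
- by rewrite bigcup_const.
- by move=> _ [A [A' [mA mA' ->]]]; exact: h.
- by move=> k; rewrite -[X in (X < _)%E]/(P1 setT) probability_setT ltry.
Qed.

(** * Positivity of the integral of a conditional square *)

Section TensorSquare.
Local Open Scope ereal_scope.
Context d1 (T1 : measurableType d1) (R : realType) (P1 : probability T1 R).

(** By Fubini the integral is the square of the integral of [f], once [f] is known to be
    integrable. *)
Lemma integral_tensor_square_ge0 (f : T1 -> R) : measurable_fun setT f ->
  (P1 \x P1).-integrable setT (fun z => (f z.1 * f z.2)%:E) ->
  0 <= \int[P1 \x P1]_z (f z.1 * f z.2)%:E.
Proof.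
move=> mf int_ff.
have mnf : measurable_fun setT (fun x => `|(f x)%:E|).
  by apply: measurableT_comp => //; exact/measurable_EFinP.
pose c := \int[P1]_x `|(f x)%:E|.
have c0 : 0 <= c by exact: integral_ge0.
(* If [c] were infinite, Tonelli would give the infinite value [c * c] for the integral of
   [|f x * f y|], against [int_ff]. *)
have int_f : P1.-integrable setT (EFin \o f).
  apply/integrableP; split; first exact/measurable_EFinP.
  rewrite -[X in X < _]/c ltey; apply/eqP => cy.
  have /integrable12ltyP := int_ff.
  move=> /(_ (measurable_int _ int_ff)) /=.
  have inner x : \int[P1]_y `|(f x * f y)%:E| = `|(f x)%:E| * c.
    under eq_integral do rewrite EFinM abseM.
    by rewrite ge0_integralZl.
  under eq_integral do rewrite inner.
  by rewrite ge0_integralZr// -/c cy.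
have fin_f := integrable_fin_num measurableT int_f.
rewrite -integral12_prod_meas1//=.
have -> : fubini_F P1 (fun z => (f z.1 * f z.2)%:E) =
    fun x => (f x)%:E * (fine (\int[P1]_y (f y)%:E))%:E.
  apply/funext => x; rewrite /fubini_F/=.
  under eq_integral do rewrite EFinM.
  by rewrite integralZl// fineK.
rewrite integralZr//.
case: (integral _ _ _) fin_f => //= r _.
by rewrite -EFinM lee_fin -expr2 sqr_ge0.
Qed.

End TensorSquare.

Section ConditionalSquare.
Local Open Scope ereal_scope.


Lemma integral_prod_ge0 d1 d2 (T1 : measurableType d1)
    (T2 : measurableType d2) (R : realType) (P1 : probability T1 R)
    (P2 : probability T2 R)
    (g : T1 * T2 -> \bar R) : (P1 \x P2).-integrable setT g ->
  (forall y, P1.-integrable setT (fun x => g (x, y)) ->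
     0 <= \int[P1]_x g (x, y)) ->
  0 <= \int[P1 \x P2]_z g z.
Proof.
move=> int_g g0; rewrite -(integral21_prod_meas1 int_g).
have mG := measurable_fubini_G int_g.
(* The sign of the inner integral is known only for integrable sections, which are almost all of
   them; there it agrees with its positive part. *)
rewrite (ae_eq_integral (fubini_G P1 g)^\+)//.
- exact: integral_ge0.
- exact: measurable_funepos.
apply: filterS (ae_integrable2 int_g) => y int_gy _.
by rewrite funeposE max_l// g0.
Qed.

(** The last component is the shared variable W; with W fixed, the integrand is a tensor square. *)
Lemma integral_conditional_square_ge0 d1 d2 (T1 : measurableType d1)
    (T2 : measurableType d2) (R : realType) (P1 : probability T1 R)
    (P2 : probability T2 R) (f : T1 * T2 -> R) : measurable_fun setT f ->
  ((P1 \x P1) \x P2).-integrable setT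
    (fun z => (f (z.1.1, z.2) * f (z.1.2, z.2))%:E) ->
  0 <= \int[(P1 \x P1) \x P2]_z (f (z.1.1, z.2) * f (z.1.2, z.2))%:E.
Proof.
move=> mf; pose P11 : probability (T1 * T1)%type R := (P1 \x P1)%E.
pose g (z : T1 * T1 * T2) := (f (z.1.1, z.2) * f (z.1.2, z.2))%:E.
rewrite -/g => int_g.
apply: (@integral_prod_ge0 _ _ _ _ _ P11 P2 g int_g).
move=> w int_w.
apply: (@integral_tensor_square_ge0 _ _ _ P1 (fun y => f (y, w)) _ int_w).
exact: (measurable_fun_pair1 w mf).
Qed.

End ConditionalSquare.

(** * Exchange of coordinates between the two tuples *)

Section Replace.
Context {R : realType} {n : nat}.
Implicit Types (a b : {set 'I_n}) (x y : n.-tuple R).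

Definition swap a (z : n.-tuple R * n.-tuple R) :=
  (replace a z.1 z.2, replace a z.2 z.1).

Lemma tnth_replace a x y k :
  tnth (replace a x y) k = if k \in a then tnth y k else tnth x k.
Proof. exact: tnth_mktuple. Qed.

(** A coordinate in both sets is exchanged and then read from the other tuple, hence restored: this
    is where the symmetric difference arises. *)
Lemma replace_swap a b z :
  replace b (swap a z).1 (swap a z).2 = replace (symdiff a b) z.1 z.2.
Proof.
apply: eq_from_tnth => k; rewrite /= !tnth_replace in_symdiff.
by case: (k \in a); case: (k \in b).
Qed.

Lemma measurable_replace d (T : measurableType d) (f g : T -> n.-tuple R) a :
  measurable_fun setT f -> measurable_fun setT g ->
  measurable_fun setT (fun t => replace a (f t) (g t)).
Proof.
move=> mf mg; apply/measurable_fun_tnthP => k.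
have -> : (@tnth n R)^~ k \o (fun t => replace a (f t) (g t)) =
    if k \in a then (@tnth n R)^~ k \o g else (@tnth n R)^~ k \o f.
  by apply/funext => t /=; rewrite tnth_replace; case: ifP.
by case: ifP => _; apply: measurableT_comp => //; exact: measurable_tnth.
Qed.

Lemma measurable_swap_tuple a : measurable_fun setT (swap a).
Proof. by apply: measurable_fun_pair; exact: measurable_replace. Qed.

End Replace.

(** * The joint law, its invariance under exchanges, and its realisation by three copies *)

Section Law.
Local Open Scope ereal_scope.
Context (R : realType) (d : measure_display) (T : measurableType d)
  (P : probability T R) (n : nat) (X X' : 'I_n -> {RV P >-> R}).
Hypothesis indep : mutually_independent (pair_family X X').
Hypothesis idist : forall k : 'I_n, identically_distributed (X k) (X' k).

Definition joint (w : T) : n.-tuple R * n.-tuple R :=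
  ([tuple X k w | k < n], [tuple X' k w | k < n]).

Lemma measurable_joint : measurable_fun setT joint.
Proof.
apply: measurable_fun_pair; apply/measurable_fun_tnthP => k.
  rewrite (_ : _ \o _ = X k)//; apply/funext => w /=; exact: tnth_mktuple.
rewrite (_ : _ \o _ = X' k)//; apply/funext => w /=; exact: tnth_mktuple.
Qed.

(** Every factor is expressed through the law of [X k], which makes the product symmetric in [A k]
    and [A' k]. *)
Lemma joint_box (A A' : 'I_n -> set R) :
  (forall k, measurable (A k)) -> (forall k, measurable (A' k)) ->
  P (joint @^-1` box A A') =
  \prod_k (P (X k @^-1` A k) * P (X k @^-1` A' k)).
Proof.
move=> mA mA'.
pose C (s : 'I_n + 'I_n) := match s with inl k => A k | inr k => A' k end.
have mC s : measurable (C s) by case: s.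
have -> : joint @^-1` box A A' =
    \bigcap_(s in [set` [set: 'I_n + 'I_n]%SET]) (pair_family X X' s @^-1` C s).
  apply/seteqP; split => [w /= h [k|k] _ /=|w h k /=]; rewrite ?tnth_mktuple.
  - by have [] := h k; rewrite /= tnth_mktuple.
  - by have [_] := h k; rewrite /= tnth_mktuple.
  - by split; [apply: (h (inl k))|apply: (h (inr k))]; rewrite /= inE.
rewrite indep// (eq_bigl xpredT) => [|s]; last by rewrite inE.
rewrite big_sumType big_split /=; congr (_ * _).
have XX' k : P (X' k @^-1` A' k) = P (X k @^-1` A' k) by apply/esym/idist.
by rewrite (eq_bigr _ (fun k _ => XX' k)).
Qed.

(** Exchanging coordinates pulls a box back to the box with the sides [A k] and [A' k] exchanged for
    [k] in [a], and [joint_box] does not see this. *)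
Lemma joint_swap_law a C : measurable C ->
  P (joint @^-1` C) = P ((swap a \o joint) @^-1` C).
Proof.
move: C; apply: same_law_boxes.
- exact: measurable_joint.
- exact: measurableT_comp (measurable_swap_tuple a) measurable_joint.
move=> A A' mA mA'.
have -> : (swap a \o joint) @^-1` box A A' = joint @^-1`
    box (fun k => if k \in a then A' k else A k)
      (fun k => if k \in a then A k else A' k).
  apply/seteqP; split => w /= h k; have := h k; rewrite /= !tnth_replace;
  by case: ifP => // _ [].
have mif (B B' : 'I_n -> set R) : (forall k, measurable (B k)) ->
    (forall k, measurable (B' k)) ->
    forall k, measurable (if k \in a then B k else B' k).
  by move=> mB mB' k; case: ifP.
rewrite (joint_box mA mA') -[RHS]/(P _).
rewrite (joint_box (mif _ _ mA' mA) (mif _ _ mA mA')).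
by apply: eq_bigr => k _; case: ifP => //; rewrite muleC.
Qed.

(* Given three independent copies of the sample, the coordinates of X in b are
   taken from the first one, those of X' in b from the second one, and all the
   others from the third one. *)
Definition mix (b : {set 'I_n}) (t : T * T * T) : n.-tuple R * n.-tuple R :=
  (replace b (joint t.2).1 (joint t.1.1).1,
   replace b (joint t.2).2 (joint t.1.2).1).

Lemma measurable_mix b : measurable_fun setT (mix b).
Proof.
have mj := measurable_joint.
by apply: measurable_fun_pair; apply: measurable_replace;
  repeat apply: measurableT_comp.
Qed.

(** A box pulls back to a rectangle, one side per copy of the sample. Each side condition of the box
    is carried by exactly one copy, so the product of the three probabilities is that of
    [joint_box]. *)
Lemma mix_law b C : measurable C ->
  P (joint @^-1` C) = ((P \x P) \x P) (mix b @^-1` C).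
Proof.
move: C; apply: same_law_boxes.
- exact: measurable_joint.
- exact: measurable_mix.
move=> A A' mA mA'.
(* A condition is dropped by making its side the whole line, which contributes a factor 1. *)
pose on_b (B : 'I_n -> set R) k := if k \in b then B k else setT.
pose off_b (B : 'I_n -> set R) k := if k \in b then setT else B k.
pose E := joint @^-1` box (on_b A) (fun=> setT).
pose E' := joint @^-1` box (on_b A') (fun=> setT).
pose F := joint @^-1` box (off_b A) (off_b A').
have m_on B : (forall k, measurable (B k)) -> forall k, measurable (on_b B k).
  by move=> mB k; rewrite /on_b; case: ifP.
have m_off B : (forall k, measurable (B k)) -> forall k, measurable (off_b B k).
  by move=> mB k; rewrite /off_b; case: ifP.
have mj B B' : (forall k, measurable (B k)) -> (forall k, measurable (B' k)) ->
    measurable (joint @^-1` box B B').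
  move=> mB mB'; rewrite -[X in measurable X]setTI.
  by apply: measurable_joint => //; exact: measurable_box.
have -> : mix b @^-1` box A A' = (E `*` E') `*` F.
  apply/seteqP; split => [[[w1 w2] w3] /= h|[[w1 w2] w3] [[/= h1 h2] h3] k].
    split; [split|] => k; have := h k;
    by rewrite /= !tnth_replace /on_b /off_b; case: (k \in b) => -[].
  have := h1 k; have := h2 k; have := h3 k.
  rewrite /= !tnth_replace /on_b /off_b.
  by case: (k \in b) => -[? ?] [? _] [? _].
have mE : measurable E by apply: mj => //; exact: m_on.
have mE' : measurable E' by apply: mj => //; exact: m_on.
have mF : measurable F by apply: mj; exact: m_off.
transitivity ((P \x P) (E `*` E') * P F); last first.
  by apply/esym/product_measure1E => //; exact: measurableX.
have -> : (P \x P) (E `*` E') = P E * P E' by exact: product_measure1E.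
have mT : forall k : 'I_n, measurable [set: R] by [].
rewrite (joint_box mA mA') (joint_box (m_on _ mA) mT).
rewrite (joint_box (m_on _ mA') mT) (joint_box (m_off _ mA) (m_off _ mA')).
rewrite -!big_split /=; apply: eq_bigr => k _.
rewrite /on_b /off_b; case: ifP => _; rewrite !preimage_setT !probability_setT.
  by rewrite !mule1.
by rewrite !mule1 !mul1e.
Qed.

End Law.

(** * Integrals of finite sums *)

Section RintegralSum.
Context d (T : measurableType d) (R : realType).
Context (mu : {measure set T -> \bar R}).
Context (I : Type) (r : seq I) (Q : pred I) (f : I -> T -> R).
Hypothesis int_f : forall i, mu.-integrable setT (EFin \o f i).

Lemma integrable_fsum :
  mu.-integrable setT (EFin \o (fun w => \sum_(i <- r | Q i) f i w)).
Proof.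
rewrite (_ : _ \o _ = fun w => (\sum_(i <- r | Q i) (EFin \o f i) w)%E).
  by apply: integrable_sum => // i _; exact: int_f.
by apply/funext => w; rewrite /= -sumEFin.
Qed.

Lemma Rintegral_sum : \int[mu]_w (\sum_(i <- r | Q i) f i w) =
  \sum_(i <- r | Q i) \int[mu]_w f i w.
Proof.
rewrite /Rintegral; under eq_integral do rewrite -sumEFin.
rewrite (integral_sum measurableT int_f) -sum_fine// => i _.
exact: integrable_fin_num (int_f i).
Qed.

End RintegralSum.

Lemma integrableZl_EFin d (T : measurableType d) (R : realType)
    (mu : {measure set T -> \bar R}) (k : R) (f : T -> R) :
  mu.-integrable setT (EFin \o f) ->
  mu.-integrable setT (EFin \o (fun w => k * f w)).
Proof. by move=> int_f; apply: (integrableZl measurableT k int_f). Qed.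

(** * Correlations and the products of differences *)

Section SquareIntegrable.
Context (R : realType) (d : measure_display) (T : measurableType d)
  (P : probability T R) (n : nat) (X X' : 'I_n -> {RV P >-> R}).
Hypothesis indep : mutually_independent (pair_family X X').
Hypothesis idist : forall k : 'I_n, identically_distributed (X k) (X' k).
Variable S : n.-tuple R -> R.
Hypothesis S_borel : measurable_fun setT S.
Hypothesis S_L2 : ('E_P[fun w => (S [tuple X k w | k < n] ^+ 2)%R] < +oo)%E.
Implicit Types (a b c : {set 'I_n}) (s : seq 'I_n).

Local Notation Z := (joint X X').
Local Notation Ssup a := (rv_of X X' (superscript (of_fun S) a)).

Let mZ : measurable_fun setT Z := measurable_joint X X'.

(** This is m(a), with S written as S with the empty superscript so that both factors have the same
    form. *)
Definition correlation a : R := \int[P]_w (Ssup finset.set0 w * Ssup a w).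

Lemma superscript_set0 (F : @functional R n) : superscript F finset.set0 = F.
Proof.
apply/funext => x; apply/funext => x'; rewrite /superscript; congr F.
by apply: eq_from_tnth => k; rewrite tnth_replace inE.
Qed.

Lemma measurable_superscript a : measurable_fun setT
  (fun z : n.-tuple R * n.-tuple R => superscript (of_fun S) a z.1 z.2).
Proof. by apply: measurableT_comp => //; exact: measurable_replace. Qed.

Lemma measurable_Ssup a : measurable_fun setT (Ssup a).
Proof. exact: measurableT_comp (measurable_superscript a) mZ. Qed.

Lemma superscript_swap a b (z : n.-tuple R * n.-tuple R) :
  superscript (of_fun S) b (swap a z).1 (swap a z).2 =
  superscript (of_fun S) (symdiff a b) z.1 z.2.
Proof. by rewrite /superscript replace_swap. Qed.

Lemma integral_swap a (F : n.-tuple R * n.-tuple R -> \bar R) :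
  measurable_fun setT F ->
  (\int[P]_w F (Z w) = \int[P]_w F (swap a (Z w)))%E.
Proof.
move=> mF; apply: (@integral_same_law _ _ _ _ _ _ _ P P Z (swap a \o Z)) => //.
  exact: measurableT_comp (measurable_swap_tuple a) mZ.
by move=> C mC; apply: joint_swap_law.
Qed.

(** Exchanging along [a] turns the superscript [a] into [symdiff a a], which is empty, so the second
    moment is that of S. *)
Lemma integrable_Ssup_sqr a :
  P.-integrable setT (EFin \o (fun w => Ssup a w ^+ 2)).
Proof.
have mF b : measurable_fun setT (fun z : n.-tuple R * n.-tuple R =>
    (superscript (of_fun S) b z.1 z.2 ^+ 2)%:E).
  apply/measurable_EFinP; apply: measurable_funX; exact: measurable_superscript.
apply/integrableP; split; first exact: measurableT_comp (mF a) mZ.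
under eq_integral do rewrite gee0_abs ?lee_fin ?sqr_ge0//.
have := integral_swap a (mF a).
under [RHS]eq_integral do rewrite superscript_swap.
move=> /= ->; move: S_L2; rewrite unlock; congr (_ < _)%E.
apply: eq_integral => w _; congr (_ ^+ 2)%:E.
have -> : symdiff a a = finset.set0.
  by apply/setP => k; rewrite in_symdiff addbb inE.
by rewrite superscript_set0.
Qed.

Lemma integrable_Ssup_mul a b :
  P.-integrable setT (EFin \o (fun w => Ssup a w * Ssup b w)).
Proof.
apply: (@le_integrable _ _ _ _ _ measurableT _
    (fun w => (Ssup a w ^+ 2)%:E + (Ssup b w ^+ 2)%:E)%E).
- by apply/measurable_EFinP; apply: measurable_funM; exact: measurable_Ssup.
- move=> w _; rewrite /= lee_fin normrM [leRHS]ger0_norm ?addr_ge0 ?sqr_ge0//.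
  rewrite -(real_normK (num_real (Ssup a w))).
  rewrite -(real_normK (num_real (Ssup b w))).
  (* For nonnegative x and y, xy is at most 2xy, which is at most the sum of the squares. *)
  set x := `|_|; set y := `|_|.
  have : 0 <= (x - y) ^+ 2 by exact: sqr_ge0.
  have : 0 <= x * y by rewrite mulr_ge0// normr_ge0.
  by nra.
- by apply: integrableD => //; exact: integrable_Ssup_sqr.
Qed.

(** Exchanging along [a] turns the superscripts empty and [symdiff a b] into [a] and [b]. *)
Lemma Rintegral_Ssup_mul a b :
  \int[P]_w (Ssup a w * Ssup b w) = correlation (symdiff a b).
Proof.
rewrite /correlation /Rintegral; congr fine.
pose F (z : n.-tuple R * n.-tuple R) :=
  (superscript (of_fun S) finset.set0 z.1 z.2 *
  superscript (of_fun S) (symdiff a b) z.1 z.2)%:E.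
have mF : measurable_fun setT F.
  apply/measurable_EFinP.
  by apply: measurable_funM; exact: measurable_superscript.
rewrite -[RHS]/(\int[P]_w F (Z w))%E (integral_swap a mF).
apply: eq_integral => w _; rewrite /F !superscript_swap symdiffK.
have -> // : symdiff a finset.set0 = a.
by apply/setP => k; rewrite in_symdiff inE addbF.
Qed.

Lemma superscript_seq_DeltaE s t x x' : uniq s ->
  superscript_seq (Delta (of_fun S) s) t x x' =
  \sum_(a : {set 'I_n} | a \subset [set:: s]%SET)
    (-1) ^+ #|a| * superscript (of_fun S) (a :|: [set:: t])%SET x x'.
Proof.
move=> us; rewrite /superscript_seq {1}/superscript DeltaE//.
by apply: eq_bigr => a _; rewrite -superscript_of_fun.
Qed.

Definition Delta_product s t (w : T) : R :=
  rv_of X X' (Delta (of_fun S) s) w *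
  rv_of X X' (superscript_seq (Delta (of_fun S) s) t) w.

Lemma Delta_productE s t : uniq s -> Delta_product s t = fun w =>
  \sum_(a : {set 'I_n} | a \subset [set:: s]%SET)
  \sum_(b : {set 'I_n} | b \subset [set:: s]%SET)
    (-1) ^+ #|a| * (-1) ^+ #|b| * (Ssup a w * Ssup (b :|: [set:: t])%SET w).
Proof.
move=> us; apply/funext => w.
rewrite /Delta_product {1 2}/rv_of superscript_seq_DeltaE// DeltaE// mulr_suml.
apply: eq_bigr => a _; rewrite mulr_sumr; apply: eq_bigr => b _.
by rewrite mulrACA.
Qed.

Lemma integrable_Delta_product s t : uniq s ->
  P.-integrable setT (EFin \o Delta_product s t).
Proof.
move=> us; rewrite Delta_productE//.
do 2 (apply: integrable_fsum => ?).
by apply: integrableZl_EFin; exact: integrable_Ssup_mul.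
Qed.

Lemma Rintegral_Delta_product s t : uniq s ->
  disjoint (mem s) (mem t) ->
  \int[P]_w Delta_product s t w = 2 ^+ size s *
    \sum_(c : {set 'I_n} | c \subset [set:: s]%SET)
      (-1) ^+ #|c| * correlation (c :|: [set:: t])%SET.
Proof.
move=> us st; rewrite Delta_productE//.
have int_term a b : P.-integrable setT (EFin \o (fun w =>
    (-1) ^+ #|a| * (-1) ^+ #|b| * (Ssup a w * Ssup (b :|: [set:: t])%SET w))).
  by apply: integrableZl_EFin; exact: integrable_Ssup_mul.
rewrite Rintegral_sum => [|a]; last exact: integrable_fsum.
have -> : size s = #|[set:: s]%SET|.
  by rewrite cardsE; apply/esym/card_uniqP.
rewrite -sum_symdiff_subset.
apply: eq_bigr => a aS; rewrite Rintegral_sum//; apply: eq_bigr => b _.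
rewrite RintegralZl//; last exact: integrable_Ssup_mul.
rewrite Rintegral_Ssup_mul; congr (_ * correlation _).
(* Since [a] lies in [s] and [t] is disjoint from [s], the union with [t] may be taken after the
   symmetric difference. *)
apply/setP => k; rewrite !(in_symdiff, finset.in_setU).
case: (boolP (k \in a)) => // ka.
have := fintype.subsetP aS _ ka; rewrite !inE => /(disjointFr st) ->.
by rewrite !orbF.
Qed.

Lemma Rintegral_Delta_product_ge0 s t : uniq s ->
  disjoint (mem s) (mem t) ->
  0 <= \int[P]_w Delta_product s t w.
Proof.
move=> us st; set b := [set:: t]%SET.
pose g (z : n.-tuple R * n.-tuple R) := Delta (of_fun S) s z.1 z.2.
have mg : measurable_fun setT g.
  rewrite /g DeltaE//; under eq_fun do rewrite -big_filter.
  apply: measurable_sum => a.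
  by apply: measurable_funM => //; exact: measurable_superscript.
(* The difference along [s] reads the second tuple only at indices in [s], all of them outside
   [b]. *)
have g_mix x x' y : g (x, replace b x' y) = g (x, x').
  rewrite /g DeltaE//=; apply: eq_bigr => a aS; congr (_ * S _).
  apply: eq_from_tnth => k; rewrite !tnth_replace; case: ifP => // ka.
  by have := fintype.subsetP aS _ ka; rewrite !inE => /(disjointFr st) ->.
pose F z := (g z * g (replace b z.1 z.2, z.2))%:E.
have mF : measurable_fun setT F.
  apply/measurable_EFinP; apply: measurable_funM => //.
  by apply: measurableT_comp => //; apply: measurable_fun_pair => //;
    exact: measurable_replace.
pose f (z : T * T) := g (replace b (Z z.2).1 (Z z.1).1, (Z z.2).2).
have mf : measurable_fun setT f.
  apply: measurableT_comp => //; apply: measurable_fun_pair.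
    by apply: measurable_replace; do 2 apply: measurableT_comp => //.
  by do 2 apply: measurableT_comp => //.
(* On three copies the factors become [f] at (first, third) and (second, third): the replacement
   along [b] overwrites the first copy by the second and keeps the third. *)
have FE u : F (mix X X' b u) = (f (u.1.1, u.2) * f (u.1.2, u.2))%:E.
  rewrite /F /mix /= !g_mix; congr (_ * g (_, _))%:E.
  by apply: eq_from_tnth => k; rewrite !tnth_replace; case: (k \in b).
have mmix := measurable_mix X X' b.
have law := mix_law indep idist b.
apply: fine_ge0; rewrite -[leRHS]/(\int[P]_w F (Z w))%E.
rewrite (integral_same_law mZ mmix law mF).
under eq_integral do rewrite FE.
apply: integral_conditional_square_ge0 => //.
rewrite -(_ : F \o mix X X' b = fun u => (f (u.1.1, u.2) * f (u.1.2, u.2))%:E).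
  apply: (integrable_same_law mZ mmix law mF).
  exact: integrable_Delta_product.
by apply/funext => u; exact: FE.
Qed.

End SquareIntegrable.

Lemma mem_indices n (i : 'S_n) p q k :
  (i k \in indices i p q) = (p <= k.+1 <= q)%N.
Proof. by rewrite (mem_map perm_inj) mem_filter mem_enum andbT. Qed.

Lemma disjoint_indices n (i : 'S_n) p q r s : (q < r)%N ->
  disjoint (mem (indices i p q)) (mem (indices i r s)).
Proof.
move=> qr; apply/pred0P => x /=; rewrite -(permKV i x) !mem_indices.
apply/negbTE/negP => /andP[/andP[_ xq] /andP[rx _]].
by have := leq_trans qr (leq_trans rx xq); rewrite ltnn.
Qed.

Lemma size_indices n (i : 'S_n) p q : (q <= n)%N ->
  size (indices i p.+1 q) = (q - p)%N.
Proof.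
move=> qn; rewrite -(card_ord_interval p qn).
have <- : #|[set:: indices i p.+1 q]%SET| = size (indices i p.+1 q).
  by rewrite cardsE; apply/card_uniqP/uniq_indices.
by rewrite set_seq_indices card_imset//; exact: perm_inj.
Qed.

(** * Differences of the averaged correlations *)

Section AverageCorrelation.
Context (R : realType) (n : nat) (m : {set 'I_n} -> R).
Local Notation J p q := [set j : 'I_n | (p <= j.+1 <= q)%N]%SET.

(** This is M_j; it starts at j = 0, where the index set is empty. *)
Definition average_over_perms (j : nat) : R :=
  n`!%:R^-1 * \sum_(i : 'S_n) m [set:: indices i 1 j]%SET.

(** The subsets in [iter_D_sum] are taken among the first [l] positions and then transported by each
    permutation [i]. *)
Lemma iter_D_average l k : (l + k <= n)%N ->
  iter l D average_over_perms k = n`!%:R^-1 * \sum_(i : 'S_n)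
    \sum_(c : {set 'I_n} | c \subset [set:: indices i 1 l]%SET)
      (-1) ^+ #|c| * m (c :|: [set:: indices i l.+1 (l + k)])%SET.
Proof.
move=> lkn; have ln := leq_trans (leq_addr k l) lkn.
have cardJ : #|J 1 l| = l by rewrite card_ord_interval ?subn0.
rewrite -[in iter l]cardJ iter_D_sum.
under [X in _ * X]eq_bigr => i _.
  rewrite set_seq_indices sum_subset_imset; over.
rewrite /= exchange_big mulr_sumr /=; apply: eq_bigr => c cJ.
rewrite /average_over_perms mulrCA; congr (_ * _); rewrite mulr_sumr.
(* The first [k + #|c|] positions are traded for [c] together with the positions from [l + 1] to
   [l + k]: both sets have the same size, which is all that the sum over permutations sees. *)
transitivity (\sum_(i : 'S_n)
    (-1) ^+ #|c| * m (i @: (c :|: J l.+1 (l + k)))%SET).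
  rewrite -!mulr_sumr; congr (_ * _).
  under eq_bigr do rewrite set_seq_indices.
  apply: sum_perm_imset.
  have cl : (#|c| <= l)%N by rewrite -cardJ subset_leq_card.
  rewrite card_ord_interval ?subn0; last first.
    by rewrite (leq_trans _ lkn)// addnC leq_add2r.
  rewrite cardsU card_ord_interval// addKn addnC.
  rewrite (_ : (c :&: _)%SET = finset.set0) ?cards0 ?subn0//.
  apply/setP => j; rewrite !inE; apply/negbTE/negP => /andP[jc /andP[lj _]].
  have := fintype.subsetP cJ _ jc; rewrite inE => jl.
  by have := leq_trans lj jl; rewrite ltnn.
apply: eq_bigr => i _; rewrite card_imset; last exact: perm_inj.
by rewrite imsetU set_seq_indices.
Qed.

End AverageCorrelation.

(** * The identity for the iterated differences, and their sign *)

Theorem theorem1p2 (R : realType) (d : measure_display) (T : measurableType d)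
  (P : probability T R) (n : nat) (n_ge1 : (1 <= n)%N)
  (X X' : 'I_n -> {RV P >-> R})
  (indep : mutually_independent (pair_family X X'))
  (idist : forall k : 'I_n, identically_distributed (X k) (X' k))
  (S : n.-tuple R -> R) (S_borel : measurable_fun [set: n.-tuple R] S)
  (S_L2 : ('E_P[fun w => (S [tuple X k w | k < n] ^+ 2)%R] < +oo)%E) :
  (forall l k : nat, (l < n)%N -> (1 <= k <= n - l)%N ->
    (iter l D (B X X' S) k)%:E =
    'E_P[fun w => ((2 ^+ l.+1 * n`!%:R)^-1 * \sum_(i : 'S_n)
      rv_of X X' (Delta (of_fun S) (indices i 1 l.+1)) w *
      rv_of X X' (superscript_seq (Delta (of_fun S) (indices i 1 l.+1))
                    (indices i l.+2 (k + l))) w)%R]%E) /\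
  completely_monotone n (B X X' S).
Proof.
pose m := correlation X X' S.
have int_mul := integrable_Ssup_mul indep idist S_borel S_L2.
(* The sequence [B] starts at 1 and the averages at 0, hence the shift of index. *)
have B_D k : B X X' S k.+1 = D (average_over_perms m) k.
  pose f (i : 'S_n) w :=
    rv_of X X' (superscript (of_fun S) finset.set0) w *
      rv_of X X' (superscript_seq (of_fun S) (indices i 1 k)) w -
    rv_of X X' (superscript (of_fun S) finset.set0) w *
      rv_of X X' (superscript_seq (of_fun S) (indices i 1 k.+1)) w.
  have int_f i : P.-integrable setT (EFin \o f i).
    exact: (integrableB measurableT (int_mul _ _) (int_mul _ _)).
  have -> : B X X' S k.+1 = \int[P]_w (n`!%:R^-1 * \sum_i f i w).
    rewrite /B unlock /Rintegral; congr fine; apply: eq_integral => w _.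
    congr (_ * _)%:E; apply: eq_bigr => i _.
    by rewrite /f superscript_set0 mulrBr.
  rewrite RintegralZl//; last exact: integrable_fsum.
  rewrite Rintegral_sum// /D /average_over_perms -mulrBr -sumrB; congr (_ * _).
  by apply: eq_bigr => i _; rewrite RintegralB//; exact: int_mul.
pose avg l k := (2 ^+ l.+1 * n`!%:R)^-1 * \sum_(i : 'S_n) \int[P]_w
  Delta_product X X' S (indices i 1 l.+1) (indices i l.+2 (k + l)) w.
have iterE l k : (l < n)%N -> (1 <= k <= n - l)%N ->
    iter l D (B X X' S) k = avg l k.
  case: k => // k ln /=; rewrite leq_subRL ?(ltnW ln)// => lkn.
  (* The shift turns the [l]-th difference of [B] at [k.+1] into the difference of order [l.+1] of
     the averages at [k]. *)
  rewrite (iter_D_shift _ _ B_D) -iterSr iter_D_average ?addSnnS// /avg.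
  rewrite invfM [_^-1 * _^-1]mulrC -mulrA; congr (_ * _); rewrite mulr_sumr.
  have pow2_neq0 : (2 : R) ^+ l.+1 != 0 by rewrite expf_neq0// pnatr_eq0.
  apply: eq_bigr => i _.
  (* The factor [2 ^+ l.+1] produced here cancels the one in the normalisation of [avg]. *)
  rewrite Rintegral_Delta_product ?uniq_indices ?disjoint_indices//.
  rewrite (size_indices i 0 ln) subn0 (mulKf pow2_neq0).
  by rewrite (_ : k.+1 + l = l.+1 + k)%N// addSnnS addnC.
have int_Delta i l k : P.-integrable setT (EFin \o
    Delta_product X X' S (indices i 1 l.+1) (indices i l.+2 (k + l))).
  by apply: integrable_Delta_product => //; exact: uniq_indices.
split=> l k ln kn; rewrite iterE//.
  rewrite unlock /avg -Rintegral_sum// -RintegralZl//; last first.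
    exact: integrable_fsum.
  rewrite fineK//; apply: integrable_fin_num => //.
  by apply: integrableZl_EFin; exact: integrable_fsum.
apply: mulr_ge0; first by rewrite invr_ge0 mulr_ge0 ?exprn_ge0 ?ler0n.
apply: sumr_ge0 => i _; apply: Rintegral_Delta_product_ge0 => //.
  exact: uniq_indices.
exact: disjoint_indices.
Qed.
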